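(* There is an absolute constant $c$ such that the following holds. Let $h_n:\mathbb{R}^n\to\mathbb{R}$, $n\ge 1$, be a sequence of functions satisfying, for all $n\geq 1$ and all real arguments, (i) $h_{n+1}(\varepsilon_1,\dots,\varepsilon_j,0,\varepsilon_{j+1},\dots,\varepsilon_n)=h_n(\varepsilon_1,\dots,\varepsilon_j,\varepsilon_{j+1},\dots,\varepsilon_n)$ for every position $j$ of the inserted zero; (ii) $\frac{\partial}{\partial\varepsilon_j}h_n(\varepsilon_1,\dots,\varepsilon_j,\dots,\varepsilon_n)\big|_{\varepsilon_j=0}=0$ for all $j=1,\dots,n$; (iii) $h_n(\varepsilon_{\pi(1)},\dots,\varepsilon_{\pi(n)})=h_n(\varepsilon_1,\dots,\varepsilon_n)$ for all permutations $\pi\in S_n$. Assume that for some constant $B>0$ one has $$|D^{\alpha}h_n(\varepsilon_1,\dots,\varepsilon_n)|\le B$$ for all $n\ge 1$, all $\varepsilon_1,\dots,\varepsilon_n\in\mathbb{R}$, and all $\alpha=(\alpha_1,\dots,\alpha_r)$ with $r\le 3$ such that $$\alpha_j\ge 2,\quad j=1,\dots,r,\qquad \sum_{j=1}^r(\alpha_j-2)\le 1.$$ Then for every $n\ge1$ and all $\varepsilon_1,\dots,\varepsilon_n\in\mathbb{R}$ the limit $$h_\infty(|\varepsilon|_2):=\lim_{k\to\infty}h_k\left(\frac{|\varepsilon|_2}{\sqrt{k}},\dots,\frac{|\varepsilon|_2}{\sqrt{k}}\right)$$ exists, and $$|h_n(\varepsilon_1,\dots,\varepsilon_n)-h_\infty(|\varepsilon|_2)|\le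 c\cdot B\cdot\max(1,|\varepsilon|_2^3)\,|\varepsilon|^3 .$$
   Context: For $\varepsilon=(\varepsilon_1,\dots,\varepsilon_n)\in\mathbb{R}^n$ and an integer $d\ge1$, the notation $|\varepsilon|^d$ means the power sum $|\varepsilon|^d:=\sum_{i=1}^n|\varepsilon_i|^d$ (it is not a power of a norm), and $|\varepsilon|_d:=(|\varepsilon|^d)^{1/d}$. Thus $|\varepsilon|_2=(\sum_i\varepsilon_i^2)^{1/2}$ is the Euclidean norm, $|\varepsilon|_2^3$ is its cube, and $|\varepsilon|^3=\sum_i|\varepsilon_i|^3$. For a vector $\alpha=(\alpha_1,\dots,\alpha_r)$ of nonnegative integers (with $r\le n$), $D^\alpha=\frac{\partial^{\alpha_1}}{\partial\varepsilon_1^{\alpha_1}}\cdots\frac{\partial^{\alpha_r}}{\partial\varepsilon_r^{\alpha_r}}$. The partial derivatives that appear are understood to exist. ''Absolute constant'' means independent of $n$, $\varepsilon$, $B$ and the sequence $(h_n)$. $S_n$ is the symmetric group on $\{1,\dots,n\}$. *)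

(* Defs.v *)
From HB Require Import structures.
From mathcomp Require Import all_boot all_order all_algebra all_fingroup.
From mathcomp Require Import all_classical all_reals all_analysis.

Set Implicit Arguments.
Unset Strict Implicit.
Unset Printing Implicit Defensive.

Import Order.TTheory GRing.Theory Num.Theory.
Import numFieldNormedType.Exports.

Local Open Scope classical_set_scope.
Local Open Scope ring_scope.

Definition powsum (R : realType) (n d : nat) (x : 'rV[R]_n) : R :=
  \sum_(i < n) `|x 0 i| ^+ d.

Definition lnorm (R : realType) (n d : nat) (x : 'rV[R]_n) : R :=
  powsum d x `^ d%:R^-1.

Definition insert0 (R : realType) (n : nat) (j : 'I_n.+1) (x : 'rV[R]_n) :
    'rV[R]_n.+1 :=
  \row_k (if unlift j k is Some i then x 0 i else 0).

Definition unit_vec (R : realType) (n : nat) (i : 'I_n) : 'rV[R]_n :=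
  delta_mx 0 i.

(* For s = [:: i1; ...; im], [pderive s f] is d/dx_i1 (... (d/dx_im f)): the
   last index of s is differentiated first. *)
Definition pderive (R : realType) (n : nat) (s : seq 'I_n) (f : 'rV[R]_n -> R) :
    'rV[R]_n -> R :=
  foldr (fun i g => 'D_(unit_vec R i) g) f s.

(* [derive] is total (a meaningless value is returned when the limit does not
   exist), so existence at every point is required at each successive stage. *)
Fixpoint pderivable (R : realType) (n : nat) (s : seq 'I_n)
    (f : 'rV[R]_n -> R) : Prop :=
  if s is i :: s' then
    pderivable s' f /\ forall x, derivable (pderive s' f) x (unit_vec R i)
  else True.

(* alpha_1 copies of the first variable, then alpha_2 copies of the second,
   and so on: the differentiations of D^alpha, written from left to right. *)
Definition multi_dirs (n r : nat) (rn : (r <= n)%N) (alpha : 'I_r -> nat) :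
    seq 'I_n :=
  flatten [seq nseq (alpha j) (widen_ord rn j) | j <- enum 'I_r].

(* The term of index 0 involves h 0 and plays no role in the limit. *)
Definition diag_seq (R : realType) (h : forall n, 'rV[R]_n -> R) (t : R) :
    R^nat :=
  fun k => h k (const_mx (t / Num.sqrt k%:R)).

Definition h_infty (R : realType) (h : forall n, 'rV[R]_n -> R) (t : R) : R :=
  limn (diag_seq h t).

(* Main.v *)
Require Import Defs.
From HB Require Import structures.
From mathcomp Require Import all_boot all_order all_algebra all_fingroup.
From mathcomp Require Import all_classical all_reals all_analysis.
From mathcomp Require Import ring lra.

Set Implicit Arguments.
Unset Strict Implicit.
Unset Printing Implicit Defensive.

Import Order.TTheory GRing.Theory Num.Theory.
Import numFieldNormedType.Exports.

Local Open Scope classical_set_scope.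
Local Open Scope ring_scope.

(** The limit compares all configurations with the same sum of squares, so the
    theorem follows if one can cut a coordinate [u] into many equal small
    coordinates [d] without changing the sum of squares, at a cost of order
    [B |u|^3] that does not depend on the number of pieces.

    The elementary move replaces a coordinate [v] by two coordinates [a], [b]
    with [v^2 = a^2 + b^2] ([merge_le], [hseq_merge]).  All first derivatives
    vanish on the coordinate hyperplanes, so by Taylor's formula both sides
    equal, to leading order, [b^2 / 2] times a pure second derivative at 0 plus
    a common term.  The two second derivatives involved are taken with the other
    coordinate equal to [a] and to [0]; as a function of that coordinate the
    second derivative is bounded and has a bounded second derivative (this is
    the mixed derivative of order [(2, 2)]), hence it is Lipschitz by Landau's
    inequality.  The third derivative controls the remainders, and one move
    costs at most [4 B v b^2].

    Cutting pieces of size [d] off [u] one after another costs [4 B u d^2] per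
    piece, and there are at most [u^2 / d^2] pieces: the total [4 B u^3] is
    independent of [d] ([hseq_peel]).  The leftover is smaller than [d], and
    dropping it costs [B d^2] ([hseq_drop]).

    With [d = |x|_2 / sqrt k], cutting every coordinate of [x] leads to at most
    [k] and at least [k - n] copies of [d], that is, to the diagonal point of
    dimension [k] up to at most [n] coordinates.  This gives
    [|h x - diag_seq k| <= 6 B |x|^3 + 2 n B |x|_2^2 / k] ([dist_diag_seq]).
    Applied to the diagonal point of dimension [k], for which
    [|x|^3 = t^3 / sqrt k], this estimate shows that the diagonal sequence is
    Cauchy, and letting [k] go to infinity in it gives the bound with [c = 6],
    the factor [max (1, |x|_2^3)] being at least 1. *)

(** * Taylor estimates in one variable *)

Section Calculus.
Context {R : realType}.
Implicit Types (f : R -> R) (a b c u v x y z K B : R).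

Lemma mvt_le f f' a b K : a <= b -> (forall x, is_derive x 1 f (f' x)) ->
  (forall c, a <= c <= b -> `|f' c| <= K) -> `|f b - f a| <= K * (b - a).
Proof.
move=> ab df f'K.
have fc : {within `[a, b], continuous f}.
  by apply: derivable_within_continuous => x _; have := df x.
have [c] := MVT_segment ab (fun x _ => df x) fc.
rewrite in_itv /= => cab ->.
rewrite normrM (ger0_norm (_ : 0 <= b - a)) ?subr_ge0//.
by rewrite ler_wpM2r ?subr_ge0// f'K.
Qed.

Lemma mvt_le0 f f' x K : (forall x, is_derive x 1 f (f' x)) ->
  (forall c, `|c| <= `|x| -> `|f' c| <= K) -> `|f x - f 0| <= K * `|x|.
Proof.
move=> df f'K; have [x0|/ltW x0] := leP 0 x.
  rewrite (ger0_norm x0) -[X in K * X]subr0; apply: (mvt_le _ df) => // c /andP[c0 cx].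
  by rewrite f'K// !ger0_norm.
rewrite distrC (ler0_norm x0) -[- x]sub0r.
apply: (mvt_le _ df) => // c /andP[xc c0].
by rewrite f'K// !ler0_norm// lerN2.
Qed.

(** Landau's inequality: the value of [f'] at a suitable point of [[c, c + 1]] is
    the increment [f (c + 1) - f c], of size at most [2 B], and [f'] varies by
    at most [B] on that interval. *)
Lemma landau_lipschitz f f' f'' B a b :
  (forall x, is_derive x 1 f (f' x)) -> (forall x, is_derive x 1 f' (f'' x)) ->
  (forall x, `|f x| <= B) -> (forall x, `|f'' x| <= B) ->
  a <= b -> `|f b - f a| <= 3 * B * (b - a).
Proof.
move=> df df' fB f''B ab; apply: (mvt_le _ df) => // c _.
have c1 : c <= c + 1 by rewrite lerDl.
have fc : {within `[c, c + 1], continuous f}.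
  by apply: derivable_within_continuous => x _; have := df x.
have [d] := MVT_segment c1 (fun x _ => df x) fc.
rewrite in_itv /= => /andP[cd d1]; rewrite addrAC subrr add0r mulr1 => fd.
have f'dc : `|f' d - f' c| <= B.
  have B0 : 0 <= B by exact: le_trans (fB 0).
  apply: le_trans (mvt_le cd df' (fun z _ => f''B z)) _.
  by rewrite -[leRHS]mulr1 ler_wpM2l// lerBlDl.
move: f'dc (fB (c + 1)) (fB c); rewrite -fd !ler_norml.
by move=> /andP[? ?] /andP[? ?] /andP[? ?]; apply/andP; split; lra.
Qed.

(** The regularity of the family in a single coordinate.  Among the derivatives
    only the second is exposed, since the estimates refer to its value at 0. *)
Definition flat_C3 B f (f'' : R -> R) : Prop := exists f' f''' : R -> R,
  [/\ forall x, is_derive x 1 f (f' x), forall x, is_derive x 1 f' (f'' x),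
      forall x, is_derive x 1 f'' (f''' x), f' 0 = 0 &
      forall x, `|f'' x| <= B /\ `|f''' x| <= B].

Lemma flat_le f f'' B x : flat_C3 B f f'' -> `|f x - f 0| <= B * x ^+ 2.
Proof.
move=> [f' [f''' [df df' _ f'0 fB]]].
have f'le y : `|f' y| <= B * `|y|.
  by rewrite -[f' y]subr0 -f'0; apply: (mvt_le0 df') => c _; case: (fB c).
rewrite -real_normK ?num_real// expr2 mulrA; apply: (mvt_le0 df) => c cx.
apply: le_trans (f'le c) _; rewrite ler_wpM2l//.
by apply: le_trans (normr_ge0 _) (fB 0).1.
Qed.

(** Comparing two values away from 0, instead of each of them with [f 0], gains
    the factor [v - u]: the function [f z - z^2 / 2 * f'' 0] has derivative at
    most [B z^2].  A separate expansion of [f u] and [f v] would only give an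
    error [B K^3], too large to be summed over many small steps. *)
Lemma flat_taylor_diff f f'' B K u v : flat_C3 B f f'' ->
  u <= v -> `|u| <= K -> `|v| <= K ->
  `|f v - f u - (v ^+ 2 - u ^+ 2) / 2 * f'' 0| <= B * K ^+ 2 * (v - u).
Proof.
move=> [f' [f''' [df df' df'' f'0 fB]]] uv uK vK.
have B0 : 0 <= B by apply: le_trans (normr_ge0 _) (fB 0).1.
have f''le y : `|f'' y - f'' 0| <= B * `|y|.
  by apply: (mvt_le0 df'') => c _; case: (fB c).
have f'le y : `|f' y - y * f'' 0| <= B * `|y| ^+ 2.
  have dg z : is_derive z 1 (fun z => f' z - z * f'' 0) (f'' z - f'' 0).
    have df'z := df' z; apply: is_derive_eq.
    by rewrite scaler0 add0r /GRing.scale /= mulr1.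
  have := @mvt_le0 _ _ y (B * `|y|) dg.
  rewrite f'0 mul0r subrr subr0 -mulrA -expr2; apply => c cy.
  by apply: le_trans (f''le c) _; rewrite ler_wpM2l.
pose g z := f z - z ^+ 2 / 2 * f'' 0.
have dg z : is_derive z 1 g (f' z - z * f'' 0).
  have dfz := df z; apply: is_derive_eq.
  by rewrite /GRing.scale /=; field.
rewrite [X in `|X|](_ : _ = g v - g u); last by rewrite /g; field.
apply: (mvt_le _ dg) => // c /andP[uc cv].
apply: le_trans (f'le c) _; rewrite ler_wpM2l// lerXn2r ?nnegrE//.
  exact: le_trans uK.
move: uK vK; rewrite !ler_norml => /andP[Ku _] /andP[_ vK].
by rewrite (le_trans Ku)// (le_trans cv).
Qed.

(** Both [F v 0 - F a 0] and [F a b - F a 0] are close to [b^2 / 2] times a second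
    derivative, namely [G 0 0] and [G a 0], because [v^2 - a^2 = b^2].  These
    differ by [O(B a)] since [G^~ 0] is Lipschitz, and the Taylor remainders are
    [B v^2 (v - a) <= B v b^2] and [B b^3]. *)
Lemma merge_le (F G : R -> R -> R) (psi' psi'' : R -> R) B a b v :
  (forall x y, F x y = F y x) -> (forall y, flat_C3 B (F^~ y) (G y)) ->
  (forall x, is_derive x 1 (G^~ 0) (psi' x)) ->
  (forall x, is_derive x 1 psi' (psi'' x)) -> (forall x, `|psi'' x| <= B) ->
  0 <= a -> 0 <= b -> 0 <= v -> v ^+ 2 = a ^+ 2 + b ^+ 2 ->
  `|F v 0 - F a b| <= 4 * B * v * b ^+ 2.
Proof.
move=> Fsym FG dpsi dpsi' psiB a0 b0 v0 vab.
have GB x y : `|G x y| <= B by have [? [? [_ _ _ _ /(_ y)[]]]] := FG x.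
have B0 : 0 <= B by apply: le_trans (GB 0 0).
have av : a <= v by rewrite -(@ler_pXn2r _ 2) ?nnegrE// vab lerDl sqr_ge0.
have bv : b <= v by rewrite -(@ler_pXn2r _ 2) ?nnegrE// vab lerDr sqr_ge0.
have := landau_lipschitz dpsi dpsi' (GB^~ 0) psiB a0; rewrite subr0 => Ga.
have b2a : `|b ^+ 2 / 2 * (G a 0 - G 0 0)| <= b ^+ 2 / 2 * (3 * B * a).
  by rewrite normrM ger0_norm ?divr_ge0 ?sqr_ge0// ler_wpM2l ?divr_ge0 ?sqr_ge0.
have := @flat_taylor_diff _ _ B b 0 b (FG a) b0.
rewrite normr0 (ger0_norm b0) lexx expr0n /= !subr0 => /(_ b0 isT) Fb.
have := @flat_taylor_diff _ _ B v a v (FG 0) av.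
rewrite (ger0_norm a0) (ger0_norm v0) lexx vab => /(_ av isT).
rewrite [X in X / 2 * G 0 0](_ : _ = b ^+ 2); last by ring.
have -> : B * (a ^+ 2 + b ^+ 2) * (v - a) = B * (v * (v ^+ 2 - v * a)).
  by rewrite -vab; ring.
have : B * (v * (v ^+ 2 - v * a)) <= B * (v * b ^+ 2).
  apply: ler_wpM2l => //; apply: ler_wpM2l => //.
  have -> : b ^+ 2 = v ^+ 2 - a * a by rewrite vab; ring.
  by rewrite lerB// ler_wpM2r.
move=> /[swap] Fv /(le_trans Fv){}Fv.
have ba : b ^+ 2 * B * a <= b ^+ 2 * B * v by rewrite ler_wpM2l ?mulr_ge0 ?sqr_ge0.
have bb : b ^+ 2 * B * b <= b ^+ 2 * B * v by rewrite ler_wpM2l ?mulr_ge0 ?sqr_ge0.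
have bv0 : 0 <= b ^+ 2 * B * v by rewrite !mulr_ge0 ?sqr_ge0.
rewrite -(Fsym b a).
move: Fb Fv b2a; rewrite (Fsym 0 a) !ler_norml => /andP[? ?] /andP[? ?] /andP[? ?].
by apply/andP; split; lra.
Qed.

End Calculus.

(** * Points of R^n as lists of coordinates *)

Section Coordinates.
Context {R : realType}.
Implicit Types (s : seq R) (n : nat).

Definition seq_rV n s : 'rV[R]_n := \row_(i < n) s`_i.

Lemma seq_rV_shift0 n s a t :
  seq_rV n.+1 (t + a :: s) = t *: unit_vec R ord0 + seq_rV n.+1 (a :: s).
Proof.
apply/rowP => -[[|i] ni]; rewrite !mxE /=; first by rewrite mulr1.
by rewrite mulr0 add0r.
Qed.

Lemma seq_rV_shift1 n s a b t :
  seq_rV n.+2 (b :: t + a :: s) =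
  t *: unit_vec R (lift ord0 ord0) + seq_rV n.+2 (b :: a :: s).
Proof.
by apply/rowP => -[[|[|i]] ni]; rewrite !mxE /= ?mulr1 ?mulr0 ?add0r.
Qed.

(** These lemmas carry the partial derivatives of the family over to the
    one-variable estimates.  In [derive_line] no derivability is assumed, so it
    also transports equations between derivatives, whether they exist or not. *)
Section Line.
Variables (n : nat) (g : 'rV[R]_n -> R) (w : 'rV[R]_n) (line : R -> 'rV[R]_n).
Hypothesis lineE : forall t a, line (t + a) = t *: w + line a.

Let quotientE a :
  (fun t : R => t^-1 *: (((g \o line) \o shift a) (t *: 1) - (g \o line) a)) =
  (fun t : R => t^-1 *: ((g \o shift (line a)) (t *: w) - g (line a))).
Proof. by apply/funext => t /=; rewrite /GRing.scale /= mulr1 lineE. Qed.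

Lemma derive_line a : 'D_1 (g \o line) a = 'D_w g (line a).
Proof. by rewrite /derive quotientE. Qed.

Lemma is_derive_line a :
  derivable g (line a) w -> is_derive a 1 (g \o line) ('D_w g (line a)).
Proof.
by move=> dg; apply: DeriveDef (derive_line a); rewrite /derivable quotientE.
Qed.

End Line.

Lemma multi_dirs1 n (rn : (1 <= n.+1)%N) (alpha : 'I_1 -> nat) :
  multi_dirs rn alpha = nseq (alpha ord0) ord0.
Proof.
rewrite /multi_dirs enum_ordSl [enum 'I_0](size0nil _) ?size_enum_ord//= cats0.
by congr nseq; exact: val_inj.
Qed.

Lemma multi_dirs2 n (rn : (2 <= n.+2)%N) (alpha : 'I_2 -> nat) :
  multi_dirs rn alpha =
  nseq (alpha ord0) ord0 ++ nseq (alpha ord_max) (lift ord0 ord0).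
Proof.
rewrite /multi_dirs !enum_ordSl [enum 'I_0](size0nil _) ?size_enum_ord//= cats0.
have <- : lift ord0 ord0 = ord_max :> 'I_2 by exact: val_inj.
by congr (nseq _ _ ++ nseq _ _); exact: val_inj.
Qed.

End Coordinates.

(** * Cutting a coordinate into small pieces *)

Section Family.
Context {R : realType}.
Variables (h : forall n : nat, 'rV[R]_n -> R) (B : R).
Hypothesis h_insert0 : forall (n : nat) (j : 'I_n.+1) (x : 'rV[R]_n),
  (0 < n)%N -> h (insert0 j x) = h x.
Hypothesis h_flat : forall (n : nat) (j : 'I_n) (x : 'rV[R]_n),
  (0 < n)%N -> x 0 j = 0 -> is_derive x (unit_vec R j) (@h n) 0.
Hypothesis h_perm : forall (n : nat) (s : 'S_n) (x : 'rV[R]_n),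
  (0 < n)%N -> h (col_perm s x) = h x.
Hypothesis h_bound : forall (n r : nat) (rn : (r <= n)%N) (alpha : 'I_r -> nat),
  (0 < n)%N -> (0 < r <= 3)%N -> (forall j : 'I_r, (2 <= alpha j)%N) ->
  (\sum_(j < r) (alpha j - 2) <= 1)%N ->
  pderivable (multi_dirs rn alpha) (@h n) /\
  forall x : 'rV[R]_n, `|pderive (multi_dirs rn alpha) (@h n) x| <= B.
Implicit Types (s : seq R) (a b u v : R).

(** The family as a single function of lists.  By insertion of zeros the dimension
    is irrelevant as long as it is positive and at least the length of the list
    ([h_seq_rV]); the extra zero coordinate used here makes the value at the
    empty list meaningful. *)
Definition hseq s : R := h (seq_rV (size s).+1 s).

Lemma h_seq_rV n s : (0 < n)%N -> (size s <= n)%N -> h (seq_rV n s) = hseq s.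
Proof.
have widen m : (0 < m)%N -> (size s <= m)%N -> h (seq_rV m.+1 s) = h (seq_rV m s).
  move=> m0 sm; rewrite -(h_insert0 ord_max (seq_rV m s))//; congr h.
  apply/rowP => k; rewrite !mxE; case: unliftP => [i ->|->]; last by rewrite nth_default.
  by rewrite mxE lift_max.
have hK k : (0 < size s + k)%N -> h (seq_rV (size s + k) s) = hseq s.
  case: k => [|k _]; first by rewrite addn0 /hseq => /widen ->.
  elim: k => [|k IH]; first by rewrite addn1.
  by rewrite addnS widen ?addnS ?IH// -?addnS ?leq_addr.
by move=> n0 /subnKC sn; rewrite -sn hK ?sn.
Qed.

Lemma hseq_cons0 s : hseq (0 :: s) = hseq s.
Proof.
rewrite [RHS]/hseq -(h_insert0 ord0 (seq_rV _ s))//; congr h.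
apply/rowP => k; rewrite !mxE; case: unliftP => [i ->|->]//.
by rewrite mxE.
Qed.

Lemma hseq_perm s1 s2 : perm_eq s1 s2 -> hseq s1 = hseq s2.
Proof.
have [->|s1N] := eqVneq s1 [::]; first by move/perm_size/esym/size0nil ->.
move=> s12; have s2N : (0 < size s2)%N by rewrite -(perm_size s12) lt0n size_eq0.
rewrite -(@h_seq_rV (size s2)) ?(perm_size s12)// -(@h_seq_rV (size s2) s2)//.
have /tuple_permP[p s1E] : perm_eq s1 (in_tuple s2) by [].
rewrite -(h_perm p (seq_rV _ s2))//; congr h; apply/rowP => i; rewrite !mxE.
rewrite s1E; have := nth_mktuple (fun i => tnth (in_tuple s2) (p i)) 0 i.
by move=> ->; rewrite (tnth_nth 0).
Qed.

Lemma flat_C3_head s : exists f'', [/\ flat_C3 B (fun a => hseq (a :: s)) f'' &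
  f'' = fun a => pderive [:: ord0; ord0] (@h (size s).+2) (seq_rV _ (a :: s))].
Proof.
set n := (size s).+2; eexists; split; last reflexivity.
have /= := @h_bound n 1 isT (fun=> 3%N) isT isT (fun=> isT).
rewrite big_ord1 multi_dirs1 => /(_ isT)[[[[_ d1] d2] d3] B3].
have /= := @h_bound n 1 isT (fun=> 2%N) isT isT (fun=> isT).
rewrite big_ord1 multi_dirs1 => /(_ isT)[_ B2].
pose e : 'rV[R]_n := unit_vec R ord0.
exists (fun a => 'D_e (@h n) (seq_rV n (a :: s))).
exists (fun a => 'D_e ('D_e ('D_e (@h n))) (seq_rV n (a :: s))).
have line t a : seq_rV n (t + a :: s) = t *: e + seq_rV n (a :: s).
  exact: seq_rV_shift0.
split; try by move=> a; apply: (is_derive_line line).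
  by apply: derive_val; apply: h_flat; rewrite // mxE.
by move=> a; split; [exact: B2|exact: B3].
Qed.

Lemma hseq_flat s : exists f'', flat_C3 B (fun a => hseq (a :: s)) f''.
Proof. by have [f'' []] := flat_C3_head s; exists f''. Qed.

Lemma B_ge0 : 0 <= B.
Proof.
have [f'' [f' [f''' [_ _ _ _ /(_ 0)[]]]]] := hseq_flat [::].
by move=> /(le_trans (normr_ge0 _)).
Qed.

Lemma hseq_drop a s : `|hseq (a :: s) - hseq s| <= B * a ^+ 2.
Proof.
by have [f'' /(@flat_le _ _ _ _ a)] := hseq_flat s; rewrite hseq_cons0.
Qed.

(** The terms of order 2 at [a] and [`|a|] agree, so only the remainder over the
    interval from [a] to [`|a|], of length at most [2 |a|], is left. *)
Lemma hseq_norm a s : `|hseq (a :: s) - hseq (`|a| :: s)| <= 2 * B * `|a| ^+ 3.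
Proof.
have [f'' /(@flat_taylor_diff _ _ _ _ `|a| a `|a|)] := hseq_flat s.
rewrite ler_norm normr_id lexx real_normK ?num_real// subrr !mul0r subr0.
move=> /(_ isT isT isT); rewrite distrC => /le_trans; apply.
have B0 := B_ge0.
have -> : 2 * B * `|a| ^+ 3 = B * a ^+ 2 * (2 * `|a|).
  by rewrite -(real_normK (num_real a)); ring.
rewrite ler_wpM2l ?(mulr_ge0 B0 (sqr_ge0 a))//.
by rewrite mulr_natl mulr2n lerD2l -normrN ler_norm.
Qed.

Lemma hseq_swap a b s : hseq (a :: b :: s) = hseq (b :: a :: s).
Proof.
by apply: hseq_perm; exact: (permEl (perm_catCA [:: a] [:: b] s)).
Qed.

(** The hypotheses give the mixed derivative with the second coordinate
    differentiated first, while [merge_le] asks for the second derivative in the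
    first coordinate as a function of the second one.  By symmetry of the family
    these are the same function. *)
Lemma hseq_merge a b v s : 0 <= a -> 0 <= b -> 0 <= v ->
  v ^+ 2 = a ^+ 2 + b ^+ 2 ->
  `|hseq (v :: s) - hseq (a :: b :: s)| <= 4 * B * v * b ^+ 2.
Proof.
move=> a0 b0 v0 vab.
have -> : hseq (v :: s) = hseq (v :: 0 :: s) by rewrite hseq_swap hseq_cons0.
set n := (size s).+3; pose i0 : 'I_n := ord0; pose i1 : 'I_n := lift ord0 ord0.
pose G y x := pderive [:: i0; i0] (@h n) (seq_rV n (x :: y :: s)).
have /= := @h_bound n 2 isT (fun=> 2%N) isT isT (fun=> isT).
rewrite big_ord_recl big_ord1 multi_dirs2 => /(_ isT)[[[[[_ d1] d11] d011] d0011] B0011].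
have line0 y t x : seq_rV n (t + x :: y :: s) =
    t *: unit_vec R i0 + seq_rV n (x :: y :: s) by exact: seq_rV_shift0.
have line1 y t x : seq_rV n (y :: t + x :: s) =
    t *: unit_vec R i1 + seq_rV n (y :: x :: s) by exact: seq_rV_shift1.
have sym (g0 g1 : 'rV[R]_n -> R) :
    (forall x y, g0 (seq_rV n (x :: y :: s)) = g1 (seq_rV n (y :: x :: s))) ->
    forall x y, 'D_(unit_vec R i0) g0 (seq_rV n (x :: y :: s)) =
                'D_(unit_vec R i1) g1 (seq_rV n (y :: x :: s)).
  move=> g01 x y; rewrite -[LHS](derive_line g0 (line0 y) x).
  rewrite -[RHS](derive_line g1 (line1 y) x).
  by congr ('D_1 _ x); apply/funext => z; exact: g01.
have GE y : G y 0 = pderive [:: i1; i1] (@h n) (seq_rV n (y :: 0 :: s)).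
  by apply: (sym _ _) => {}y z; apply: (sym _ _) => {}y {}z; exact: hseq_swap.
have Gflat y : flat_C3 B (fun x => hseq (x :: y :: s)) (G y).
  by have [f'' [+ f''E]] := flat_C3_head (y :: s); rewrite f''E.
have dG (x : R) : is_derive x 1 (G^~ 0)
    (pderive [:: i0; i1; i1] (@h n) (seq_rV n (x :: 0 :: s))).
  rewrite (_ : G^~ 0 =
    pderive [:: i1; i1] (@h n) \o (fun x => seq_rV n (x :: 0 :: s))).
    exact: is_derive_line.
  by apply/funext => y; exact: GE.
have ddG (x : R) : is_derive x 1
    (fun x : R => pderive [:: i0; i1; i1] (@h n) (seq_rV n (x :: 0 :: s)))
    (pderive [:: i0; i0; i1; i1] (@h n) (seq_rV n (x :: 0 :: s))).
  exact: (@is_derive_line _ _ (pderive [:: i0; i1; i1] (@h n)) _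
    (fun x => seq_rV n (x :: 0 :: s)) (line0 0) x (d0011 _)).
have hsym x y : hseq (x :: y :: s) = hseq (y :: x :: s) by exact: hseq_swap.
have B4 x : `|pderive [:: i0; i0; i1; i1] (@h n) (seq_rV n (x :: 0 :: s))| <= B.
  exact: B0011.
exact: (@merge_le _ (fun x y => hseq (x :: y :: s)) G _ _ _ _ _ _
  hsym Gflat dG ddG B4).
Qed.

(** The head of the list only decreases while pieces are cut off, so each of the
    [m] moves costs at most [4 B u d^2]. *)
Lemma hseq_peel u d s m : 0 <= u -> 0 <= d -> m%:R * d ^+ 2 <= u ^+ 2 ->
  `|hseq (u :: s) -
    hseq (Num.sqrt (u ^+ 2 - m%:R * d ^+ 2) :: nseq m d ++ s)|
  <= 4 * B * u * (m%:R * d ^+ 2).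
Proof.
move=> u0 d0; elim: m => [|m IH] mu.
  by rewrite /= mul0r subr0 sqrtr_sqr (ger0_norm u0) subrr normr0 mulr0.
have mS : m.+1%:R * d ^+ 2 = m%:R * d ^+ 2 + d ^+ 2 by rewrite -natr1 mulrDl mul1r.
have d2 := sqr_ge0 d; have md0 : 0 <= m%:R * d ^+ 2 by rewrite mulr_ge0.
have B0 := B_ge0.
have mu' : m%:R * d ^+ 2 <= u ^+ 2 by lra.
set v := Num.sqrt (u ^+ 2 - m%:R * d ^+ 2) in IH *.
set w := Num.sqrt _; have v0 : 0 <= v := sqrtr_ge0 _; have w0 : 0 <= w := sqrtr_ge0 _.
have v2 : v ^+ 2 = u ^+ 2 - m%:R * d ^+ 2 by rewrite sqr_sqrtr// subr_ge0.
have w2 : w ^+ 2 = u ^+ 2 - m.+1%:R * d ^+ 2 by rewrite sqr_sqrtr// subr_ge0.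
have vu : v <= u by rewrite -(@ler_pXn2r _ 2) ?nnegrE// v2; lra.
have := @hseq_merge w d v (nseq m d ++ s) w0 d0 v0; rewrite v2 w2 mS.
move=> /(_ ltac:(ring)) vd.
have := IH mu'; move: vd; rewrite [nseq m.+1 d ++ s]/=.
have : B * d ^+ 2 * v <= B * d ^+ 2 * u by rewrite ler_wpM2l ?mulr_ge0.
by rewrite !ler_norml => ? /andP[? ?] /andP[? ?]; apply/andP; split; lra.
Qed.

(** The constant 6 is 2 for replacing [u] by its absolute value and 4 for cutting
    off the pieces. *)
Lemma hseq_split_head u d s : 0 < d -> exists m : nat,
  m%:R * d ^+ 2 <= u ^+ 2 <= m%:R * d ^+ 2 + d ^+ 2 /\
  `|hseq (u :: s) - hseq (nseq m d ++ s)| <= 6 * B * `|u| ^+ 3 + B * d ^+ 2.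
Proof.
move=> d0; have d2 : 0 < d ^+ 2 by rewrite exprn_gt0.
have /truncn_itv/andP[] : 0 <= u ^+ 2 / d ^+ 2 by rewrite divr_ge0 ?sqr_ge0.
set m := Num.truncn _; rewrite ler_pdivlMr// ltr_pdivrMr// -natr1 mulrDl mul1r.
move=> mu /ltW um; exists m; split; first by rewrite mu um.
have B0 := B_ge0; have u0 := normr_ge0 u.
have u2 : `|u| ^+ 2 = u ^+ 2 by rewrite real_normK ?num_real.
have := hseq_norm u s.
have := @hseq_peel `|u| d s m u0 (ltW d0); rewrite u2 => /(_ mu).
have := hseq_drop (Num.sqrt (u ^+ 2 - m%:R * d ^+ 2)) (nseq m d ++ s).
rewrite sqr_sqrtr ?subr_ge0//.
have : B * `|u| * (m%:R * d ^+ 2) <= B * `|u| * (`|u| ^+ 2).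
  by rewrite u2 ler_wpM2l ?mulr_ge0.
have : B * (u ^+ 2 - m%:R * d ^+ 2) <= B * d ^+ 2 by rewrite ler_wpM2l// lerBlDl.
rewrite !ler_norml => ? ? /andP[? ?] /andP[? ?] /andP[? ?].
by apply/andP; split; lra.
Qed.

(** The copies of [d] in the tail store the pieces of the coordinates already cut,
    which keeps the coordinate to be cut at the head of the list. *)
Lemma hseq_split s d N : 0 < d -> exists M : nat,
  [/\ M%:R * d ^+ 2 <= \sum_(u <- s) u ^+ 2,
      \sum_(u <- s) u ^+ 2 <= (M + size s)%:R * d ^+ 2 &
  `|hseq (s ++ nseq N d) - hseq (nseq (M + N) d)|
     <= 6 * B * (\sum_(u <- s) `|u| ^+ 3) + (size s)%:R * B * d ^+ 2].
Proof.
move=> d0; elim: s N => [|u s IH] N.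
  by exists 0%N; rewrite !big_nil !mul0r subrr normr0 mulr0 addr0.
have [m [/andP[mu um] um_le]] := hseq_split_head u (s ++ nseq N d) d0.
have [M [Ms sM sM_le]] := IH (m + N)%N.
exists (m + M)%N; rewrite !big_cons /= !natrD -natr1 !mulrDl !mul1r.
rewrite natrD mulrDl in sM; split; [lra|lra|].
have E : hseq (nseq m d ++ s ++ nseq N d) = hseq (s ++ nseq (m + N) d).
  by apply: hseq_perm; rewrite perm_catCA nseqD.
move: um_le sM_le; rewrite E -addnA addnCA !ler_norml.
by move=> /andP[? ?] /andP[? ?]; apply/andP; split; lra.
Qed.

Lemma hseq_drop_nseq d m p :
  `|hseq (nseq (m + p) d) - hseq (nseq m d)| <= p%:R * B * d ^+ 2.
Proof.
elim: p => [|p IH]; first by rewrite addn0 subrr normr0 !mul0r.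
have := hseq_drop d (nseq (m + p) d); rewrite addnS -natr1 !mulrDl mul1r.
by move: IH; rewrite !ler_norml => /andP[? ?] /andP[? ?]; apply/andP; split; lra.
Qed.

(** * Distance to the diagonal sequence *)

Lemma lnorm2_sqr n (x : 'rV[R]_n) : lnorm 2 x ^+ 2 = powsum 2 x.
Proof.
have p0 : 0 <= powsum 2 x by rewrite sumr_ge0// => i _; rewrite exprn_ge0.
by rewrite /lnorm powR12_sqrt// sqr_sqrtr.
Qed.

Lemma dist_diag_seq n (x : 'rV[R]_n) k : (0 < n)%N -> (0 < k)%N ->
  `|h x - diag_seq h (lnorm 2 x) k| <=
    6 * B * powsum 3 x + 2 * n%:R * B * powsum 2 x / k%:R.
Proof.
move=> n0 k0; have kR : 0 < k%:R :> R by rewrite ltr0n.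
have B0 := B_ge0.
have x2E := lnorm2_sqr x; set t := lnorm 2 x in x2E *.
have t0 : 0 <= t by exact: powR_ge0.
pose s : n.-tuple R := [tuple x 0 i | i < n]; set d := t / Num.sqrt k%:R.
have d2 : d ^+ 2 = powsum 2 x / k%:R by rewrite /d exprMn exprVn sqr_sqrtr// x2E.
have hx : h x = hseq s.
  rewrite -(h_seq_rV n0) ?size_tuple//; congr h; apply/rowP => i.
  by rewrite mxE nth_mktuple.
have hd : diag_seq h t k = hseq (nseq k d).
  rewrite -(h_seq_rV k0) ?size_nseq// /diag_seq; congr h; apply/rowP => i.
  by rewrite !mxE nth_nseq ltn_ord.
have s2 : \sum_(u <- s) u ^+ 2 = powsum 2 x.
  by rewrite big_tuple; apply: eq_bigr => i _; rewrite tnth_mktuple real_normK ?num_real.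
have s3 : \sum_(u <- s) `|u| ^+ 3 = powsum 3 x.
  by rewrite big_tuple; apply: eq_bigr => i _; rewrite tnth_mktuple.
have p3 : 0 <= powsum 3 x by rewrite sumr_ge0// => i _; rewrite exprn_ge0.
(* If [t = 0] the step [d] vanishes and nothing can be cut, but then [x = 0]. *)
rewrite hx hd; have [tE|tN] := eqVneq t 0.
  have x0 i : x 0 i = 0.
    apply/eqP; rewrite -normr_eq0 -sqrf_eq0; apply/eqP.
    have := x2E; rewrite tE expr0n /= => /esym.
    by move=> /psumr_eq0P -> // j _; rewrite exprn_ge0.
  have hseq0 m : hseq (nseq m 0) = hseq [::] by elim: m => // m IH; rewrite /= hseq_cons0.
  have -> : s = nseq n 0 :> seq R.
    apply: (@eq_from_nth _ 0); rewrite size_tuple ?size_nseq// => i ni.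
    by rewrite -[i]/(val (Ordinal ni)) nth_mktuple x0 nth_nseq ni.
  rewrite /d tE mul0r !hseq0 subrr normr0 -x2E tE expr0n /= mulr0 mul0r addr0.
  by rewrite !mulr_ge0.
have dpos : 0 < d by rewrite divr_gt0 ?sqrtr_gt0// lt_def tN.
have d2pos : 0 < d ^+ 2 by rewrite exprn_gt0.
have [M []] := hseq_split s 0 dpos.
rewrite s2 s3 size_tuple addn0 cats0.
have -> : powsum 2 x = k%:R * d ^+ 2 by rewrite d2 mulrC divfK ?gt_eqF.
rewrite !ler_pM2r// !ler_nat => Mk kM sM.
(* The cut produces [M] pieces with [M <= k <= M + n]; the missing ones are added. *)
have : `|hseq (nseq k d) - hseq (nseq M d)| <= n%:R * B * d ^+ 2.
  have := hseq_drop_nseq d M (k - M); rewrite subnKC// => /le_trans; apply.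
  by rewrite !ler_wpM2r ?ler_nat ?leq_subLR// ltW.
have -> : 2 * n%:R * B * (k%:R * d ^+ 2) / k%:R = 2 * (n%:R * B * d ^+ 2).
  by field; rewrite gt_eqF.
move: sM; rewrite !ler_norml => /andP[? ?] /andP[? ?].
by apply/andP; split; lra.
Qed.

End Family.

(** * Convergence of the diagonal sequence *)

Section DiagonalSequence.
Context {R : realType}.
Implicit Types (C e t : R) (k : nat).

Lemma near_div_le C e : 0 < e -> \forall k \near \oo, C / k%:R <= e.
Proof.
move=> e0; near=> k; have k0 : 0 < k%:R :> R.
  by rewrite ltr0n; near: k; exact: nbhs_infty_gt.
rewrite ler_pdivrMr// mulrC -ler_pdivrMr//.
by near: k; exact: nbhs_infty_ger.
Unshelve. all: by end_near. Qed.

Lemma near_div_sqrt_le C e : 0 < e ->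
  \forall k \near \oo, C / Num.sqrt k%:R <= e.
Proof.
move=> e0; near=> k; have k0 : 0 < k%:R :> R.
  by rewrite ltr0n; near: k; exact: nbhs_infty_gt.
rewrite ler_pdivrMr ?sqrtr_gt0// mulrC -ler_pdivrMr//.
apply: le_trans (ler_norm _) _; rewrite -sqrtr_sqr ler_wsqrtr//.
by near: k; exact: nbhs_infty_ger.
Unshelve. all: by end_near. Qed.

Lemma powsum_diag t k d : (0 < k)%N -> 0 <= t ->
  powsum d (const_mx (t / Num.sqrt k%:R) : 'rV[R]_k) =
  k%:R * (t / Num.sqrt k%:R) ^+ d.
Proof.
move=> k0 t0; rewrite /powsum (eq_bigr (fun=> (t / Num.sqrt k%:R) ^+ d)).
  by rewrite sumr_const card_ord mulr_natl.
by move=> i _; rewrite mxE ger0_norm// divr_ge0// sqrtr_ge0.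
Qed.

Lemma lnorm2_diag t k : (0 < k)%N -> 0 <= t ->
  lnorm 2 (const_mx (t / Num.sqrt k%:R) : 'rV[R]_k) = t.
Proof.
move=> k0 t0; have kR : 0 < k%:R :> R by rewrite ltr0n.
apply/eqP; rewrite -(@eqrXn2 _ 2) ?powR_ge0// lnorm2_sqr powsum_diag//.
by rewrite exprMn exprVn (sqr_sqrtr (ltW kR)) mulrC divfK// gt_eqF.
Qed.

End DiagonalSequence.

Section Limit.
Context {R : realType}.
Variables (h : forall n : nat, 'rV[R]_n -> R) (B : R).
Hypothesis dist_diag : forall n (x : 'rV[R]_n) k, (0 < n)%N -> (0 < k)%N ->
  `|h x - diag_seq h (lnorm 2 x) k| <=
    6 * B * powsum 3 x + 2 * n%:R * B * powsum 2 x / k%:R.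

(** The distance estimate at the diagonal point of dimension [k] bounds
    [|diag_seq k - diag_seq l|] by [6 B t^3 / sqrt k + 2 k B t^2 / l]: [k] is fixed
    first to make the first term small, then [l] goes to infinity. *)
Lemma cvg_diag_seq t : 0 <= t -> cvgn (diag_seq h t).
Proof.
move=> t0; apply/cauchy_cvgP; apply: cauchy_exP => e e0.
have e3 : 0 < e / 3 by rewrite divr_gt0.
near \oo => k; have k0 : (0 < k)%N by near: k; exact: nbhs_infty_gt.
have ek : 6 * B * t ^+ 3 / Num.sqrt k%:R <= e / 3.
  by near: k; exact: near_div_sqrt_le.
exists (diag_seq h t k).
suff : \forall l \near \oo, ball (diag_seq h t k) e (diag_seq h t l) by [].
near=> l.
have l0 : (0 < l)%N by near: l; exact: nbhs_infty_gt.
have kR : 0 < k%:R :> R by rewrite ltr0n.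
have := dist_diag (const_mx (t / Num.sqrt k%:R) : 'rV[R]_k) k0 l0.
rewrite lnorm2_diag// !powsum_diag//.
have -> : 6 * B * (k%:R * (t / Num.sqrt k%:R) ^+ 3) = 6 * B * t ^+ 3 / Num.sqrt k%:R.
  have sk : Num.sqrt k%:R != 0 :> R by rewrite gt_eqF// sqrtr_gt0.
  by rewrite -{1}(sqr_sqrtr (ltW kR)); field.
have : 2 * k%:R * B * (k%:R * (t / Num.sqrt k%:R) ^+ 2) / l%:R <= e / 3.
  by near: l; exact: near_div_le.
rewrite /ball /= -/(diag_seq h t k) => le le'.
apply: le_lt_trans le' _; lra.
Unshelve. all: by end_near. Qed.

Lemma dist_h_infty n (x : 'rV[R]_n) : (0 < n)%N ->
  `|h x - h_infty h (lnorm 2 x)| <= 6 * B * powsum 3 x.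
Proof.
move=> n0; have hcvg : cvgn (diag_seq h (lnorm 2 x)).
  by apply: cvg_diag_seq; exact: powR_ge0.
have dcvg : (fun k => `|h x - diag_seq h (lnorm 2 x) k|) @ \oo -->
    `|h x - h_infty h (lnorm 2 x)|.
  by apply: cvg_norm; apply: cvgB => //; exact: cvg_cst.
apply/ler_addgt0Pr => e e0; apply: (cvgr_to_le dcvg); near=> k.
have k0 : (0 < k)%N by near: k; exact: nbhs_infty_gt.
apply: le_trans (dist_diag x n0 k0) _; rewrite lerD2l.
by near: k; exact: near_div_le.
Unshelve. all: by end_near. Qed.

End Limit.

Theorem theorem2p1 (R : realType) :
  exists c : R, forall (h : forall n : nat, 'rV[R]_n -> R) (B : R),
    (forall (n : nat) (j : 'I_n.+1) (x : 'rV[R]_n), (0 < n)%N ->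
       h n.+1 (insert0 j x) = h n x) ->
    (forall (n : nat) (j : 'I_n) (x : 'rV[R]_n), (0 < n)%N -> x 0 j = 0 ->
       is_derive x (unit_vec R j) (h n) 0) ->
    (forall (n : nat) (s : 'S_n) (x : 'rV[R]_n), (0 < n)%N ->
       h n (col_perm s x) = h n x) ->
    0 < B ->
    (forall (n r : nat) (rn : (r <= n)%N) (alpha : 'I_r -> nat),
       (0 < n)%N -> (0 < r <= 3)%N ->
       (forall j : 'I_r, (2 <= alpha j)%N) ->
       (\sum_(j < r) (alpha j - 2) <= 1)%N ->
       pderivable (multi_dirs rn alpha) (h n) /\
       forall x : 'rV[R]_n, `|pderive (multi_dirs rn alpha) (h n) x| <= B) ->
    forall (n : nat) (x : 'rV[R]_n), (0 < n)%N ->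
      cvgn (diag_seq h (lnorm 2 x)) /\
      `|h n x - h_infty h (lnorm 2 x)|
        <= c * B * Num.max 1 (lnorm 2 x ^+ 3) * powsum 3 x.
Proof.
exists 6 => h B h0 h1 h2 B0 hB n x n0.
have dist := dist_diag_seq h0 h1 h2 hB.
split; first by apply: (cvg_diag_seq dist); exact: powR_ge0.
apply: le_trans (dist_h_infty dist x n0) _; apply: ler_wpM2r.
  by rewrite sumr_ge0// => i _; rewrite exprn_ge0.
by rewrite ler_peMr ?mulr_ge0 ?(ltW B0)// le_max lexx.
Qed.
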